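(* Let $k,t,n$ be positive integers with $t\le k$ and $n\ge t(k-t)+2$. If $\mathcal{F}$ is a $t$-intersecting family of $k$-multisets of $[n]$, then $$|\mathcal{F}|\le\binom{n+k-t-1}{k-t}.$$
   Context: $[n]=\{1,\dots,n\}$. A multiset $F$ of $[n]$ is a sequence $(m(1,F),\dots,m(n,F))$ of non-negative integers; its cardinality is $|F|=\sum_{i=1}^n m(i,F)$, and $F$ is a $k$-multiset if $|F|=k$. The intersection $F\cap G$ is the multiset with multiplicities $\min\{m(i,F),m(i,G)\}$. A family (set) $\mathcal{F}$ of multisets is $t$-intersecting if $|F_1\cap F_2|\ge t$ for all $F_1,F_2\in\mathcal{F}$. *)

(* Defs.v *)
From mathcomp Require Import all_boot finmap multiset.

Set Implicit Arguments.
Unset Strict Implicit.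
Unset Printing Implicit Defensive.

Local Open Scope fset_scope.
Local Open Scope mset_scope.
Local Open Scope nat_scope.

(* For F : {mset 'I_n}, F i is the multiplicity of i in F; the ground set
   {1, ..., n} is shifted to {0, ..., n - 1}. Note that #|F| would only count
   the distinct elements of F, hence the explicit sum of multiplicities. *)
Definition mset_card (n : nat) (F : {mset 'I_n}) : nat := \sum_(i < n) F i.

Definition k_multiset (n k : nat) (F : {mset 'I_n}) : Prop := mset_card F = k.

(* F1 = F2 is allowed; F1 `&` F2 has multiplicities minn (F1 i) (F2 i). *)
Definition t_intersecting (n t : nat) (FF : {fset {mset 'I_n}}) : Prop :=
  forall F1 F2 : {mset 'I_n}, F1 \in FF -> F2 \in FF ->
    t <= mset_card (F1 `&` F2).

(* Main.v *)
Require Import Defs.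
From mathcomp Require Import all_boot finmap multiset zify.

(** Write N = n + k - 1.  The number of k-multisets of [n] with nonempty support S is
    C(k - 1, |S| - 1) = C(N - n, k - |S|), which is also the number of k-subsets
    of [N] whose trace on [n] is S.  So if the supports of the members of the
    family t-intersect, the family is no larger than a t-intersecting family of
    k-subsets of [N], and n >= t(k-t)+2 says exactly that N >= (t+1)(k-t+1),
    the range in which such a family has at most C(N - t, k - t) members.

    Making the supports t-intersect.  For i <> j, the map exchanging the
    multiplicities (a, b) of i and j for (b + 1, a - 1) is a reflection.
    Applying it to the members with a > b + 1, unless the image is already
    there, preserves the t-intersection property ([compressed_family]), for the
    reason that makes two-point symmetrization contract distances, and it lowers
    the sum of the squares of the multiplicities.  Let the family be stable under
    all these moves.  If i has multiplicity at least 2 in two members F and G and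
    n >= 2k - t, then some j occurs in neither, and the move of F at (i, j)
    lowers the overlap with G without changing the common support; the overlap
    being always at least t, so is the common support ([supp_overlap]).  The
    hypothesis on n gives n >= 2k - t when t >= 2 and k > t.  For t = 1 the
    supports intersect because the multisets do, and for k = t the family has at
    most one member.

    The bound for sets ([weighted_t_intersecting]) is an induction that removes
    the points of the ground set D one at a time, each set A being weighted by
    the number of k-subsets of [N] with trace A on D.  Fix x in D; by shifting, x
    may be exchanged in any member for any absent point.  A member A
    containing x is critical if A - x is not in the family.  Two critical members
    that meet in exactly t points cover D, because otherwise x could be exchanged
    in one of them for an uncovered point.  One then keeps A - x for A in a
    subfamily W of the critical members in which any two meet in more than t
    points, and drops the other critical members; together with the members
    avoiding x this gives a family on D - x.  Sets of sizes a and b can only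
    conflict when a + b = |D| + t; for a <> b one keeps the profitable one of the
    two sizes ([selection_by_size]), and for a = b the sets that avoid a
    well-chosen point ([selection_middle]).  The latter is where
    N >= (t+1)(k-t+1) is needed in full. *)

Set Implicit Arguments.
Unset Strict Implicit.
Unset Printing Implicit Defensive.

(** * Weights of traces *)

(** The number of k-subsets of a set of m + M points whose trace on a given set
    of m points is a given a-set.  The factor is needed because of truncated
    subtraction. *)
Definition wt (k M a : nat) : nat := (a <= k) * 'C(M, k - a).

Lemma wtS k M a : wt k M.+1 a = wt k M a + wt k M a.+1.
Proof.
rewrite /wt; case: (ltngtP a k) => [ltak | // | ->].
  by rewrite !mul1n -(subnSK ltak) binS addnC.
by rewrite subnn !bin0.
Qed.

(** The ratio of C(M, k-a+1) to C(M, k-a) is (M-k+a) / (k-a+1), and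
    M - k + a >= k - b + 1 as soon as M + m > 2k - t, so that the denominator
    for b is at most the numerator for a, and conversely. *)
Lemma wt_pair k t m M a b : t <= k -> 0 < t -> a + b = m + t -> 0 < a -> 0 < b ->
  t.+1 * (k - t).+1 <= M + m ->
  wt k M a * wt k M b <= wt k M a.-1 * wt k M b.-1.
Proof.
move=> le_tk t_gt0 eq_ab a_gt0 b_gt0 leN; rewrite /wt.
case: (leqP a k) => [le_ak|]; last by rewrite mul0n.
case: (leqP b k) => [le_bk|]; last by rewrite mul0n muln0.
rewrite (leq_trans (leq_pred a) le_ak) (leq_trans (leq_pred b) le_bk) !mul1n.
have -> : k - a.-1 = (k - a).+1 by lia.
have -> : k - b.-1 = (k - b).+1 by lia.
have le2k : k.*2.+1 <= M + (a + b) by nia.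
rewrite -(@leq_pmul2l ((k - a).+1 * (k - b).+1)) //.
rewrite [leqRHS]mulnACA !mul_bin_left [leqRHS]mulnACA leq_mul2r.
by rewrite [leqLHS]mulnC leq_mul ?orbT //; lia.
Qed.

(** With a = t + r and m = t + 2r, the inequality follows from
    (2 + (t-1)/r) (k-t+1) <= M + m, whose left-hand side is largest at r = 1,
    where it is (t+1)(k-t+1). *)
Lemma wt_middle k t m M a : t <= k -> 0 < t -> t < m -> a + a = m + t ->
  t.+1 * (k - t).+1 <= M + m ->
  m.-1 * wt k M a <= (m - a) * wt k M.+1 a.-1.
Proof.
move=> le_tk t_gt0 lt_tm eq_aa leN; rewrite /wt.
case: (leqP a k) => [le_ak|]; last by rewrite mul0n muln0.
rewrite (leq_trans (leq_pred a) le_ak) !mul1n.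
have -> : k - a.-1 = (k - a).+1 by lia.
(* Both sides become multiples of C(M, k-a) after multiplication by k-a+1. *)
rewrite -(@leq_pmul2l (k - a).+1) // mulnCA [leqRHS]mulnCA -mul_bin_diag.
rewrite !mulnA leq_mul2r; apply/orP; right.
have [r def_a] : exists r, a = t + r.+1 by exists (a - t).-1; lia.
have [u def_t] : exists u, t = u.+1 by exists t.-1; lia.
have [p def_k] : exists p, k = a + p by exists (k - a); lia.
have def_m : m = t + r.+1.*2 by lia.
have : u.+2 * (r + p + 2) <= M + m by move: leN; rewrite def_t; congr (_ * _ <= _); lia.
have -> : k - a = p by lia.
have -> : m - a = r.+1 by lia.
rewrite def_m def_t /= => {}leN; nia.
Qed.

(** * Compression of t-intersecting families *)

(** The common form of shifting for sets and of the reflections for multisets.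
    The move [sg j] is to be applied to the members satisfying [P j] whose image
    is absent; the conditions on [cap] say that it acts like a reflection, which
    does not decrease the intersection of two points of the side [P j] and moves
    each point of that side closer to all points of the other one.
    The potential [mu] bounds the number of moves.  The last two conclusions
    transport whatever the moves preserve, in particular the size (for f = 1). *)
Lemma compressed_family (K : choiceType) (J : finType) (P : J -> pred K)
    (sg : J -> K -> K) (cap : K -> K -> nat) (mu : K -> nat) (t : nat) :
    (forall A B, cap A B = cap B A) ->
    (forall j, {in P j &, injective (sg j)}) ->
    (forall j A, P j A -> mu (sg j A) < mu A) ->
    (forall j A B, P j A -> P j B -> cap A B <= cap (sg j A) (sg j B)) ->
    (forall j A B, P j A -> P j B -> cap A (sg j B) <= cap (sg j A) B) ->
    (forall j A B, P j A -> ~~ P j B -> cap A B <= cap (sg j A) B) ->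
  forall s : seq K, uniq s -> {in s &, forall A B, t <= cap A B} ->
  exists s' : seq K,
    [/\ uniq s', {in s' &, forall A B, t <= cap A B},
        forall j A, A \in s' -> P j A -> sg j A \in s',
        forall Q : pred K, (forall j A, P j A -> Q A -> Q (sg j A)) ->
          all Q s -> all Q s'
      & forall f : K -> nat, (forall j A, P j A -> f (sg j A) = f A) ->
          \sum_(A <- s') f A = \sum_(A <- s) f A].
Proof.
move=> capC sg_inj sg_mu cap2 cap1 cap0 s.
have [b le_b] := ubnP (\sum_(A <- s) mu A); elim: b s le_b => // b IHb s le_b us cap_s.
case: (boolP [exists j, has (fun A => P j A && (sg j A \notin s)) s]); last first.
  move/existsPn => stab; exists s; split=> // j A sA PA.
  by apply: contraNT (stab j) => sgA; apply/hasP; exists A; rewrite ?PA.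
case/existsP=> j /hasP[A0 sA0 /andP[PA0 sgA0]].
pose g A := if P j A && (sg j A \notin s) then sg j A else A.
have g_inj : {in s &, injective g}.
  move=> A B sA sB; rewrite /g.
  case: ifP => [/andP[PA nA]|_]; case: ifP => [/andP[PB nB]|_] //.
  - exact: sg_inj.
  - by move=> eqB; rewrite eqB sB in nA.
  - by move=> eqA; rewrite -eqA sA in nB.
(* If B stays in place although P j B holds, then sg j B is a member too, and
   its intersection with A bounds that of sg j A with B. *)
have cap_g : {in s &, forall A B, t <= cap (g A) (g B)}.
  have half A B : A \in s -> B \in s -> P j A -> ~~ (P j B && (sg j B \notin s)) ->
      t <= cap (sg j A) B.
    move=> sA sB PA; rewrite negb_and negbK.
    case: (boolP (P j B)) => /= [PB sgB | nPB _].
      exact: leq_trans (cap_s _ _ sA sgB) (cap1 _ _ _ PA PB).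
    exact: leq_trans (cap_s _ _ sA sB) (cap0 _ _ _ PA nPB).
  move=> A B sA sB; rewrite /g.
  case: ifPn => [/andP[PA nA]|nA]; case: ifPn => [/andP[PB nB]|nB].
  - exact: leq_trans (cap_s _ _ sA sB) (cap2 _ _ _ PA PB).
  - exact: half.
  - by rewrite capC; apply: half.
  - exact: cap_s.
have ug : uniq [seq g A | A <- s] by rewrite map_inj_in_uniq.
have mu_g : \sum_(A <- [seq g A | A <- s]) mu A < b.
  rewrite -ltnS; apply: leq_trans le_b.
  rewrite ltnS big_map (big_rem A0) //= [ltnRHS](big_rem A0) //=.
  rewrite -addSn leq_add //; first by rewrite /g PA0 sgA0 sg_mu.
  apply: leq_sum => A _; rewrite /g; case: ifP => // /andP[PA _].
  by rewrite ltnW // sg_mu.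
have cap_g' : {in [seq g A | A <- s] &, forall A B, t <= cap A B}.
  by move=> _ _ /mapP[A sA ->] /mapP[B sB ->]; apply: cap_g.
have [s' [us' cap_s' stab allQ sumf]] := IHb _ mu_g ug cap_g'.
exists s'; split=> // [Q QP Qs | f fP].
  apply: allQ => //; apply/allP => _ /mapP[A sA ->]; rewrite /g.
  by case: ifP => [/andP[PA _]|_]; [apply: QP => // |]; apply: (allP Qs).
rewrite sumf // big_map; apply: eq_bigr => A _; rewrite /g.
by case: ifP => // /andP[PA _]; apply: fP.
Qed.

(** An additive form of the comparison of two sums that differ at x and y only,
    suited to linear arithmetic over the natural numbers. *)
Lemma sum_off_pair (T : finType) (x y : T) (F G : T -> nat) : x != y ->
    (forall z, z != x -> z != y -> F z = G z) ->
  \sum_z F z + (G x + G y) = \sum_z G z + (F x + F y).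
Proof.
move=> xy FG; rewrite (bigD1 x) //= (bigD1 y) 1?eq_sym //=.
rewrite [\sum_z G z](bigD1 x) //= [\sum_(i | _) G i](bigD1 y) 1?eq_sym //=.
rewrite (eq_bigr G) => [|z /andP[zx zy]]; last exact: FG.
lia.
Qed.

Lemma card_setI_sum (T : finType) (A B : {set T}) :
  #|A :&: B| = \sum_z minn (z \in A) (z \in B).
Proof.
rewrite -sum1_card big_mkcond; apply: eq_bigr => z _.
by rewrite inE; do 2!case: (_ \in _).
Qed.

(** * The bound for weighted set families *)

(** Only the shifts that replace x are needed for removing x from the ground
    set; each application lowers the number of members containing x. *)
Lemma shift_family (T : finType) (D : {set T}) (x : T) (t : nat)
    (G : {set {set T}}) :
    {in G &, forall A B : {set T}, t <= #|A :&: B|} ->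
    {in G, forall A : {set T}, A \subset D} ->
  exists G' : {set {set T}},
    [/\ {in G' &, forall A B : {set T}, t <= #|A :&: B|},
        {in G', forall A : {set T}, A \subset D},
        forall (A : {set T}) i, A \in G' -> x \in A -> i \in D -> i \notin A ->
          i |: (A :\ x) \in G'
      & forall f : nat -> nat,
          \sum_(A in G') f #|A| = \sum_(A in G) f #|A|].
Proof.
move=> tG DG.
pose P i (A : {set T}) := [&& x \in A, i \in D & i \notin A].
pose sg i (A : {set T}) := i |: (A :\ x).
have PE i A : P i A -> [/\ x \in A, i \notin A, i \in D & x != i].
  by case/and3P=> xA iD iA; split=> //; apply: contraNneq iA => <-.
have sgE i A z : (z \in sg i A) = (z == i) || (z != x) && (z \in A).
  by rewrite !inE.
have capC (A B : {set T}) : #|A :&: B| = #|B :&: A| by rewrite setIC.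
have card_sg i A : P i A -> #|sg i A| = #|A|.
  case/PE=> xA iA _ xi.
  by rewrite /sg cardsU1 !inE negb_and iA orbT [in RHS](cardsD1 x) xA.
have sg_inj i : {in P i &, injective (sg i)}.
  move=> A B /PE[xA iA _ xi] /PE[xB iB _ _] /setP eqAB; apply/setP=> z.
  have := eqAB z; rewrite !sgE.
  case: (eqVneq z x) => [-> | zx]; first by rewrite xA xB.
  by case: (eqVneq z i) => [-> | zi] //=; rewrite (negPf iA) (negPf iB).
have sg_mu i A : P i A -> (x \in sg i A) < (x \in A).
  by case/PE=> xA iA _ xi; rewrite sgE xA eqxx (negPf xi).
have off (A B A' B' : {set T}) i : x != i ->
    (forall z, z != x -> z != i -> (z \in A) = (z \in A') /\ (z \in B) = (z \in B')) ->
  #|A :&: B| + (minn (x \in A') (x \in B') + minn (i \in A') (i \in B')) =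
  #|A' :&: B'| + (minn (x \in A) (x \in B) + minn (i \in A) (i \in B)).
  move=> xi eqz; rewrite !card_setI_sum.
  apply: (sum_off_pair (F := fun z => minn (z \in A) (z \in B))
    (G := fun z => minn (z \in A') (z \in B'))) => // z zx zi.
  by have [-> ->] := eqz z zx zi.
have sg_off i A z : z != x -> z != i -> (z \in sg i A) = (z \in A).
  by move=> zx zi; rewrite sgE zx (negPf zi).
have cap2 i A B : P i A -> P i B -> #|A :&: B| <= #|sg i A :&: sg i B|.
  move=> /PE[xA iA _ xi] /PE[xB iB _ _].
  have := @off A B (sg i A) (sg i B) i xi (fun z zx zi =>
    conj (esym (sg_off i A z zx zi)) (esym (sg_off i B z zx zi))).
  by rewrite !sgE !eqxx xA xB (negPf xi) (negPf iA) /=; lia.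
have cap1 i A B : P i A -> P i B -> #|A :&: sg i B| <= #|sg i A :&: B|.
  move=> /PE[xA iA _ xi] /PE[xB iB _ _].
  have := @off A (sg i B) (sg i A) B i xi (fun z zx zi =>
    conj (esym (sg_off i A z zx zi)) (sg_off i B z zx zi)).
  by rewrite !sgE !eqxx xA xB (negPf xi) (negPf iA) (negPf iB) /=; lia.
have cap0 i A B : P i A -> ~~ P i B -> #|A :&: B| <= #|sg i A :&: B|.
  move=> /PE[xA iA iD xi]; rewrite /P iD /= negb_and negbK => xiB.
  have := @off A B (sg i A) B i xi (fun z zx zi =>
    conj (esym (sg_off i A z zx zi)) erefl).
  rewrite !sgE !eqxx xA (negPf xi) (negPf iA) /=; move: xiB.
  by case: (x \in B); case: (i \in B) => //= _; lia.
have [|s' [us' tS stab allQ sumf]] :=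
    @compressed_family _ T P sg (fun A B => #|A :&: B|) (fun A => x \in A) t
      capC sg_inj sg_mu cap2 cap1 cap0 (enum G) (enum_uniq _).
  by move=> A B; rewrite !mem_enum; apply: tG.
exists [set A in s']; split.
- by move=> A B; rewrite !inE; apply: tS.
- have /allP subD : all (fun A : {set T} => A \subset D) s'.
    apply: allQ => [i A /PE[_ _ iD _] AD|].
      by rewrite subUset sub1set iD (subset_trans (subD1set _ _)).
    by apply/allP => A; rewrite mem_enum; apply: DG.
  by move=> A; rewrite inE; apply: subD.
- by move=> A i; rewrite !inE => sA xA iD iA; apply: stab => //; rewrite /P xA iD.
move=> f; rewrite (eq_bigl (mem s')) => [|A]; last by rewrite !inE.
rewrite -big_uniq //= sumf => [|i A PA]; last by rewrite card_sg.
by rewrite big_enum.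
Qed.

(** Here n a is the number of critical members of size a, v a the loss for
    dropping one of them and u a the gain for keeping one.  If neither of the
    sizes a and b were profitable, then n a u a < n b v b and n b u b < n a v a,
    and the product of the two contradicts the hypothesis. *)
Lemma selection_by_size (c : nat) (n u v : nat -> nat) :
    (forall a b, a + b = c -> 0 < n a -> 0 < n b -> v a * v b <= u a * u b) ->
  exists win : nat -> bool, forall a b, a + b = c -> a != b -> 0 < n a ->
    win b = ~~ win a /\ (~~ win a -> n a * v a <= n b * u b).
Proof.
move=> uv.
exists (fun a => if a < c - a then n (c - a) * v (c - a) <= n a * u a
                 else ~~ (n a * v a <= n (c - a) * u (c - a))).
move=> a b eq_ab ne_ab na_gt0.
have -> : c - a = b by lia.
have -> : c - b = a by lia.
case: (ltngtP a b) ne_ab => // [lt_ab | lt_ba] _; last first.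
  by rewrite negbK.
split=> //; rewrite -ltnNge => lt_b; rewrite leqNgt; apply/negP => lt_a.
have nb_gt0 : 0 < n b by case: (n b) lt_b.
have := ltn_mul lt_a lt_b; rewrite ltnNge => /negP; apply.
rewrite [leqRHS]mulnC [leqLHS]mulnACA [leqRHS]mulnACA.
by rewrite leq_mul2l uv ?orbT.
Qed.

(** By averaging: a set A of size a containing x is avoided by |D| - a of the
    |D| - 1 points i of D - x, so some i is avoided by at least the proportion
    (|D| - a) / (|D| - 1) of the sets. *)
Lemma selection_middle (T : finType) (D : {set T}) (x : T) (a u v : nat)
    (B : {set {set T}}) : x \in D -> 1 < #|D| ->
    {in B, forall A : {set T}, [/\ x \in A, A \subset D & #|A| = a]} ->
    #|D|.-1 * v <= (#|D| - a) * (u + v) ->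
  exists2 i, i \in D :\ x &
    #|[set A in B | i \in A]| * v <= #|[set A in B | i \notin A]| * u.
Proof.
move=> xD D_gt1 inB le_uv; set m := #|D| in D_gt1 le_uv.
have cardDx : #|D :\ x| = m.-1 by rewrite /m (cardsD1 x D) xD.
apply/exists_inP; apply: contraT; rewrite negb_exists_in => /forall_inP noi.
pose N i := #|[set A in B | i \notin A]|.
have cardN i : #|[set A in B | i \in A]| + N i = #|B|.
  rewrite -(cardsID [set A : {set T} | i \in A] B) /N.
  congr (_ + _); apply: eq_card => A.
    by rewrite !inE.
  by rewrite !inE andbC.
have lt_i i : i \in D :\ x -> N i * (u + v) < #|B| * v.
  by move=> /noi; rewrite -(cardN i) -ltnNge -/(N i); nia.
(* Double counting of the pairs (i, A) with i outside A. *)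
have sumN : \sum_(i in D :\ x) N i = #|B| * (m - a).
  transitivity (\sum_(i in D :\ x) \sum_(A in B) (i \notin A)).
    apply: eq_bigr => i _; rewrite /N -sum1_card big_mkcond [RHS]big_mkcond.
    by apply: eq_bigr => A _; rewrite inE; case: (A \in B); case: (i \in A).
  rewrite exchange_big -sum_nat_const; apply: eq_bigr => A /inB[xA AD cA].
  have -> : m - a = #|D :\: A| by rewrite cardsD (setIidPr AD) cA.
  rewrite -sum1_card big_mkcond [RHS]big_mkcond; apply: eq_bigr => i _.
  rewrite !inE; case: (eqVneq i x) => [->|_] /=; first by rewrite xA.
  by case: (i \in D); case: (i \in A).
have : \sum_(i in D :\ x) (N i * (u + v)).+1 <= \sum_(i in D :\ x) #|B| * v.
  by apply: leq_sum => i; apply: lt_i.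
rewrite sum_nat_const cardDx; under eq_bigr do rewrite -addn1.
rewrite big_split /= -big_distrl /= sumN sum1_card cardDx.
rewrite mulnCA -mulnA => le_sum; have := leq_mul (leqnn #|B|) le_uv.
move=> /(leq_trans le_sum); rewrite -[leqRHS]addn0 leq_add2l leqn0.
by case: (m) D_gt1 => [|[]].
Qed.

(** The subfamily of the critical members [B] that survive the removal of x: a
    member A of W contributes A - x as well, and the members outside W are
    dropped, so that the total weight does not decrease. *)
Lemma selection (T : finType) (k t M : nat) (D : {set T}) (x : T)
    (B : {set {set T}}) :
    0 < t -> t <= k -> t < #|D| -> t.+1 * (k - t).+1 <= M + #|D| -> x \in D ->
    {in B, forall A : {set T}, x \in A /\ A \subset D} ->
    {in B &, forall A A' : {set T}, t <= #|A :&: A'|} ->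
    {in B &, forall A A' : {set T}, #|A :&: A'| = t -> A :|: A' = D} ->
  exists W : {set {set T}},
    [/\ W \subset B, {in W &, forall A A' : {set T}, t < #|A :&: A'|}
      & \sum_(A in B :\: W) wt k M #|A| <= \sum_(A in W) wt k M #|A|.-1].
Proof.
move=> t_gt0 le_tk lt_tD leN xD inB tB coverB.
pose c := #|D| + t; pose Bs a := [set A in B | #|A| == a]; pose n a := #|Bs a|.
have cardB A : A \in B -> t <= #|A| <= #|D|.
  move=> BA; have := tB _ _ BA BA; rewrite setIid => ->.
  by rewrite subset_leq_card // (proj2 (inB _ BA)).
have n_gt0 a : 0 < n a -> t <= a <= #|D|.
  by case/card_gt0P=> A; rewrite inE => /andP[BA /eqP<-]; apply: cardB.
have [|win winP] := @selection_by_size c n (fun a => wt k M a.-1) (wt k M).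
  move=> a b eq_ab na nb; apply: (@wt_pair k t #|D|) => //.
    by case/andP: (n_gt0 _ na) => /(leq_trans t_gt0).
  by case/andP: (n_gt0 _ nb) => /(leq_trans t_gt0).
(* The point i matters only when c is even; any i will do otherwise. *)
pose h := c./2.
have [i Di le_i] : exists2 i, i \in D :\ x & h + h = c ->
    #|[set A in Bs h | i \in A]| * wt k M h <=
    #|[set A in Bs h | i \notin A]| * wt k M h.-1.
  have [eq_hc | ne_hc] := eqVneq (h + h) c; last first.
    have /card_gt0P[i Di] : 0 < #|D :\ x| by move: lt_tD; rewrite (cardsD1 x D) xD; lia.
    by exists i => // eq_hc; rewrite eq_hc eqxx in ne_hc.
  have [||i Di le_i] := @selection_middle T D x h (wt k M h.-1) (wt k M h)
      (Bs h) xD (leq_ltn_trans t_gt0 lt_tD); last by exists i.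
    by move=> A; rewrite inE => /andP[BA /eqP cA]; have [xA AD] := inB _ BA.
  have h_gt0 : 0 < h by move: eq_hc; rewrite /c; lia.
  by have := @wt_middle k t #|D| M h le_tk t_gt0 lt_tD eq_hc leN; rewrite wtS prednK.
pose W := [set A in B | if #|A| + #|A| == c then i \notin A else win #|A|].
exists W; split.
- by apply/subsetP => A; rewrite inE => /andP[].
- move=> A A'; rewrite !inE => /andP[BA WA] /andP[BA' WA'].
  rewrite ltn_neqAle tB // andbT eq_sym; apply/eqP => eq_t.
  have covA := coverB _ _ BA BA' eq_t.
  have eq_c : #|A| + #|A'| = c by rewrite -cardsUI covA eq_t.
  case: (eqVneq #|A| #|A'|) => [eqA | neA].
    rewrite -eqA in eq_c WA'; move: WA WA'; rewrite eq_c eqxx => iA iA'.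
    by move: Di; rewrite -covA !inE (negPf iA) (negPf iA') andbF.
  have nA : 0 < n #|A| by apply/card_gt0P; exists A; rewrite inE BA /=.
  have [eq_win _] := winP _ _ eq_c neA nA.
  by move: WA WA'; rewrite !ifF => [winA||]; rewrite ?eq_win ?winA //; apply/eqP; lia.
have by_size (S : {set {set T}}) f : S \subset B ->
    \sum_(A in S) f #|A| = \sum_(a < c.+1) #|[set A in S | #|A| == a]| * f a.
  move=> /subsetP SB.
  rewrite (partition_big (fun A : {set T} => inord #|A| : 'I_c.+1) predT) //=.
  apply: eq_bigr => a _; rewrite -sum_nat_const; apply: congr_big => // A.
    rewrite !inE; case SA: (A \in S) => //=; rewrite -val_eqE /= inordK //.
    by have := cardB _ (SB _ SA); lia.
  case/andP=> SA /eqP <-; rewrite inordK //.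
  by have := cardB _ (SB _ SA); lia.
rewrite !(@by_size _ (fun a => wt k M a)) ?subsetDl //.
rewrite (@by_size W (fun a => wt k M a.-1)); last first.
  by apply/subsetP => A; rewrite inE => /andP[].
(* The loss in size a is paid for by the gain in size c - a. *)
rewrite [leqRHS](reindex_inj rev_ord_inj) /=.
apply: leq_sum => -[a /= lt_ac] _; rewrite subSS; set b := c - a.
have eq_ab : a + b = c by rewrite subnKC.
case: (eqVneq a b) => [eqab | neab].
  have def_h : h = a by rewrite /h -eq_ab -eqab addnn doubleK.
  have eq_h : h + h = c by rewrite def_h {2}eqab.
  rewrite -eqab -def_h; have := le_i eq_h; congr (_ * _ <= _ * _); apply: eq_card => A.
    rewrite !inE; case: (A \in B) => //=.
    case: (eqVneq #|A| h) => [->|]; last by rewrite andbF.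
    by rewrite eq_h eqxx !andbT negbK.
  rewrite !inE; case: (A \in B) => //=.
  case: (eqVneq #|A| h) => [->|]; last by rewrite andbF.
  by rewrite eq_h eqxx !andbT.
have sizeW d e : d + e = c -> d != e ->
    [set A in W | #|A| == d] = if win d then Bs d else set0.
  move=> eq_de ne_de; apply/setP => A; rewrite !inE.
  have -> : (A \in if win d then Bs d else set0) = [&& A \in B, #|A| == d & win d].
    by case: (win d); rewrite !inE ?andbT ?andbF.
  case: (A \in B) => //=; case: (eqVneq #|A| d) => [->|]; last by rewrite andbF.
  by rewrite andbT ifF //; apply/eqP; lia.
have -> : [set A in B :\: W | #|A| == a] = if win a then set0 else Bs a.
  apply/setP => A; have /setP/(_ A) := sizeW _ _ eq_ab neab.
  by case: (win a); rewrite !inE; case: (A \in B) => //=; case: (#|A| == a);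
    rewrite ?andbF ?andbT // => ->.
case: (ltnP 0 (n a)) => [na | ]; last first.
  by case: ifP => _; rewrite ?cards0 // leqn0 => /eqP na; rewrite -/(n a) na.
have [eq_win] := winP _ _ eq_ab neab na.
case: ifP => [|lose_a]; first by rewrite cards0.
move=> /(_ isT) => le_ab; apply: leq_trans le_ab _.
have eq_ba : b + a = c by rewrite addnC.
by rewrite (sizeW _ _ eq_ba) 1?eq_sym // eq_win lose_a.
Qed.

(** The induction step.  The new family consists of the members avoiding x and
    of the sets A - x for A in the selection W.  A non-critical member A
    containing x is accounted for by A - x, since the weight of C relative to
    D - x is that of C plus that of C + x relative to D. *)
Lemma descend (T : finType) (k t M : nat) (D : {set T}) (x : T)
    (G : {set {set T}}) :
    0 < t -> t <= k -> t < #|D| -> t.+1 * (k - t).+1 <= M + #|D| -> x \in D ->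
    {in G, forall A : {set T}, A \subset D} ->
    {in G &, forall A B : {set T}, t <= #|A :&: B|} ->
  exists H : {set {set T}},
    [/\ {in H, forall A : {set T}, A \subset D :\ x},
        {in H &, forall A B : {set T}, t <= #|A :&: B|}
      & \sum_(A in G) wt k M #|A| <= \sum_(A in H) wt k M.+1 #|A|].
Proof.
move=> t_gt0 le_tk lt_tD leN xD DG0 tG0.
have [G' [tG DG shG sumG]] := shift_family x tG0 DG0.
rewrite -{}sumG {G DG0 tG0}; rename G' into G.
pose B := [set A in G | (x \in A) && (A :\ x \notin G)].
have capD1 (A C : {set T}) : x \in A -> x \in C -> #|A :&: C| = #|(A :\ x) :&: C|.+1.
  by move=> xA xC; rewrite (cardsD1 x) inE xA xC setIDAC.
have inB A : A \in B -> [/\ A \in G, x \in A, A :\ x \notin G & A \subset D].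
  by rewrite inE => /and3P[GA xA nA]; split=> //; apply: DG.
have [|||W [WB tW leW]] := selection t_gt0 le_tk lt_tD leN xD (B := B).
- by move=> A /inB[].
- by move=> A C /inB[GA _ _ _] /inB[GC _ _ _]; apply: tG.
- move=> A C /inB[GA xA _ AD] /inB[GC xC _ CD] eq_t.
  (* A point i outside A and C could replace x in A, leaving t-1 common points. *)
  apply/eqP; rewrite eqEsubset subUset AD CD; apply/subsetP => i iD.
  rewrite inE -[_ || _]negbK negb_or; apply/negP => /andP[iA iC].
  have := tG _ _ (shG A i GA xA iD iA) GC.
  rewrite -eq_t (capD1 _ _ xA xC) ltnNge => /negP; apply.
  apply/subset_leq_card/subsetP => z; rewrite !inE => /andP[/orP[/eqP->|zA] zC].
    by rewrite zC in iC.
  by rewrite zA zC.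
have inW A : A \in W -> [/\ A \in G, x \in A, A :\ x \notin G & A \subset D].
  by move/(subsetP WB)/inB.
pose G0 := [set C in G | x \notin C]; pose W1 := [set A :\ x | A in W].
have D1_inj (S : {set {set T}}) : {in S, forall A : {set T}, x \in A} ->
    {in S &, injective (fun A : {set T} => A :\ x)}.
  by move=> xS A C /xS xA /xS xC /= eqAC; rewrite -(setD1K xA) eqAC setD1K.
exists (G0 :|: W1); split.
- move=> A; rewrite !inE => /orP[/andP[GA xA] | /imsetP[C /inW[_ _ _ CD] ->]].
    by rewrite subsetD1 xA DG.
  exact: setSD.
- have tG0W (C A : {set T}) : C \in G0 -> A \in W -> t <= #|(A :\ x) :&: C|.
    rewrite inE => /andP[GC xC] /inW[GA _ _ _].
    have -> : (A :\ x) :&: C = A :&: C.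
      apply/setP => z; rewrite !inE; case: eqP => [->|] //=.
      by rewrite (negPf xC) andbF.
    exact: tG.
  move=> A C; rewrite ![_ \in _ :|: _]inE.
  move=> /orP[GA | /imsetP[A' WA ->]] /orP[GC | /imsetP[C' WC ->]].
  + by move: GA GC; rewrite !inE => /andP[GA _] /andP[GC _]; apply: tG.
  + by rewrite setIC; apply: tG0W.
  + exact: tG0W.
  + have [_ xA _ _] := inW _ WA; have [_ xC _ _] := inW _ WC.
    have := tW _ _ WA WC; rewrite (capD1 _ _ xA xC) ltnS.
    congr (_ <= _); apply: eq_card => z; rewrite !inE.
    by case: (z == x); rewrite /= ?andbF.
have dis : [disjoint G0 & W1].
  rewrite -setI_eq0; apply/eqP/setP => A; rewrite !inE; apply/negP.
  by move=> /andP[/andP[GA _] /imsetP[C /inW[_ _ nC _] eqA]]; move: nC; rewrite -eqA GA.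
rewrite [leqRHS](eq_bigl [predU G0 & W1]) => [|A]; last by rewrite in_setU.
rewrite bigU //= [X in _ <= _ + X]big_imset /=; last first.
  by apply: D1_inj => A /inW[].
pose G1 := [set C in G | (x \in C) && (C :\ x \in G)].
have -> : \sum_(A in G) wt k M #|A| = \sum_(A in G0) wt k M #|A| +
    \sum_(A in G1) wt k M #|A| + \sum_(A in B) wt k M #|A|.
  rewrite (bigID (fun A : {set T} => x \in A)) /= addnC -addnA; congr (_ + _).
    by apply: eq_bigl => A; rewrite inE.
  rewrite (bigID (fun A : {set T} => A :\ x \in G)) /=; congr (_ + _).
    by apply: eq_bigl => A; rewrite !inE andbA.
  by apply: eq_bigl => A; rewrite !inE andbA.
apply: leq_add.
  under [leqRHS]eq_bigr do rewrite wtS.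
  rewrite big_split leq_add2l.
  have xG1 : {in G1, forall A : {set T}, x \in A} by move=> A; rewrite inE => /and3P[].
  have -> : \sum_(A in G1) wt k M #|A| =
            \sum_(A in [set A :\ x | A in G1]) wt k M #|A|.+1.
    rewrite big_imset /=; last exact: D1_inj.
    by apply: eq_bigr => A /xG1 xA; rewrite (cardsD1 x A) xA.
  rewrite [leqRHS](big_setID [set A :\ x | A in G1]) /=.
  rewrite (setIidPr _) ?leq_addr //; apply/subsetP => _ /imsetP[C + ->].
  by rewrite !inE eqxx => /and3P[_ _ ->].
rewrite (bigID (mem W)) /= (eq_bigl (mem W)) => [|A]; last first.
  by rewrite /= andbC; case WA: (A \in W) => //=; rewrite (subsetP WB).
have -> : \sum_(A in W) wt k M.+1 #|A :\ x| =
    \sum_(A in W) wt k M #|A| + \sum_(A in W) wt k M #|A|.-1.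
  rewrite -big_split; apply: eq_bigr => A /inW[_ xA _ _].
  by rewrite /= wtS (cardsD1 x A) xA addnC.
rewrite leq_add2l; apply: leq_trans leW; apply: eq_leq.
by apply: eq_bigl => A; rewrite in_setD andbC.
Qed.

(** The Frankl-Wilson bound for t-intersecting families of k-subsets of a set of
    M + |D| points, in the form where membership depends on the trace on D only.
    When D has at most t points, D itself is the only possible trace. *)
Theorem weighted_t_intersecting (T : finType) (k t M : nat) (D : {set T})
    (G : {set {set T}}) :
    0 < t -> t <= k -> t.+1 * (k - t).+1 <= M + #|D| ->
    {in G, forall A : {set T}, A \subset D} ->
    {in G &, forall A B : {set T}, t <= #|A :&: B|} ->
  \sum_(A in G) wt k M #|A| <= 'C(M + #|D| - t, k - t).
Proof.
move=> t_gt0 le_tk; move def_m: #|D| => m.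
elim: m D M G def_m => [|m IHm] D M G def_m leN DG tG.
  case: (set_0Vmem G) => [->|[A GA]]; first by rewrite big_set0.
  have := tG _ _ GA GA; rewrite setIid => /leq_trans/(_ (subset_leq_card (DG _ GA))).
  by rewrite def_m leqNgt t_gt0.
case: (ltnP t #|D|) => [lt_tD | le_Dt].
  have /card_gt0P[x xD] : 0 < #|D| by rewrite def_m.
  rewrite -def_m in leN.
  have [H [DH tH leH]] := descend t_gt0 le_tk lt_tD leN xD DG tG.
  apply: leq_trans leH _; rewrite addnS -addSn; apply: IHm DH tH.
    by move: def_m; rewrite (cardsD1 x) xD => -[].
  by rewrite addSnnS -def_m.
case: (set_0Vmem G) => [->|[A0 GA0]]; first by rewrite big_set0.
have all_D A : A \in G -> t <= #|A| /\ A = D.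
  move=> GA; have := tG _ _ GA GA; rewrite setIid => le_tA; split=> //.
  by apply/eqP; rewrite eqEcard DG // (leq_trans le_Dt).
have [le_t eqD] := all_D _ GA0.
have -> : G = [set D].
  apply/eqP; rewrite eqEsubset sub1set -{2}eqD GA0 andbT.
  by apply/subsetP => A /all_D[_ ->]; rewrite inE.
have eq_t : #|D| = t by apply/eqP; rewrite eqn_leq le_Dt -eqD.
by rewrite big_set1 -def_m eq_t addnK /wt le_tk mul1n.
Qed.

(** * Multisets with t-intersecting supports *)

Section Multisets.

Variable T : finType.
Implicit Types F G : {ffun T -> nat}.

Definition mass F := \sum_z F z.
Definition overlap F G := \sum_z minn (F z) (G z).
Definition supp F : {set T} := [set z | F z != 0].

(** Reflection of the difference of the multiplicities at p.1 and p.2 about 1;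
    it is meaningful as soon as p.1 has positive multiplicity. *)
Definition polarize (p : T * T) F : {ffun T -> nat} :=
  [ffun z => if z == p.1 then (F p.2).+1 else if z == p.2 then (F p.1).-1 else F z].

(** The side of the reflection from which multisets are moved. *)
Definition steep (p : T * T) F := (F p.2).+1 < F p.1.

Lemma steep_neq p F : steep p F -> p.2 != p.1.
Proof. by rewrite /steep; apply: contraTneq => ->; rewrite ltnNge leqnSn. Qed.

Lemma polarize1 p F : polarize p F p.1 = (F p.2).+1.
Proof. by rewrite ffunE eqxx. Qed.

Lemma polarize2 p F : p.2 != p.1 -> polarize p F p.2 = (F p.1).-1.
Proof. by move=> /negPf np; rewrite ffunE np eqxx. Qed.

Lemma polarize_off p F z : z != p.1 -> z != p.2 -> polarize p F z = F z.
Proof. by move=> /negPf z1 /negPf z2; rewrite ffunE z1 z2. Qed.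

Lemma polarize_inj p : {in steep p &, injective (polarize p)}.
Proof.
move=> F G sF sG eqFG; apply/ffunP => z; have np := steep_neq sF.
have eqz y : polarize p F y = polarize p G y by rewrite eqFG.
have := eqz p.1; have := eqz p.2; rewrite !polarize1 !polarize2 // => e2 [e1].
have {}sF : (F p.2).+1 < F p.1 by []; have {}sG : (G p.2).+1 < G p.1 by [].
have [->|z1] := eqVneq z p.1; first by rewrite -(ltn_predK sF) e2 (ltn_predK sG).
have [->|z2] := eqVneq z p.2; first exact: e1.
by have := eqz z; rewrite !polarize_off.
Qed.

Lemma mass_polarize p F : steep p F -> mass (polarize p F) = mass F.
Proof.
move=> sF; have np := steep_neq sF.
have := @sum_off_pair T p.1 p.2 (polarize p F) F; rewrite eq_sym np.
move=> /(_ isT (@polarize_off p F)); rewrite polarize1 polarize2 //.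
by move: sF; rewrite /steep /mass; move: (F p.1) (F p.2) => a b; lia.
Qed.

Lemma energy_polarize p F : steep p F ->
  \sum_z polarize p F z ^ 2 < \sum_z F z ^ 2.
Proof.
move=> sF; have np := steep_neq sF.
have := @sum_off_pair T p.1 p.2 (fun z => polarize p F z ^ 2) (fun z => F z ^ 2).
rewrite eq_sym np => /(_ isT (fun z z1 z2 =>
  congr1 (expn^~ 2) (polarize_off F z1 z2))).
rewrite polarize1 polarize2 //.
by move: sF; rewrite /steep; move: (F p.1) (F p.2) => a b; nia.
Qed.

Lemma overlap_off_pair F G F' G' p : p.2 != p.1 ->
    (forall z, z != p.1 -> z != p.2 -> F z = F' z /\ G z = G' z) ->
  overlap F G + (minn (F' p.1) (G' p.1) + minn (F' p.2) (G' p.2)) =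
  overlap F' G' + (minn (F p.1) (G p.1) + minn (F p.2) (G p.2)).
Proof.
move=> np FG; apply: (@sum_off_pair T p.1 p.2 (fun z => minn (F z) (G z))
  (fun z => minn (F' z) (G' z))) => [|z z1 z2]; first by rewrite eq_sym.
by have [-> ->] := FG z z1 z2.
Qed.

Lemma overlapC F G : overlap F G = overlap G F.
Proof. by apply: eq_bigr => z _; rewrite minnC. Qed.

Lemma overlap_polarize2 p F G : steep p F -> steep p G ->
  overlap F G <= overlap (polarize p F) (polarize p G).
Proof.
move=> sF sG; have np := steep_neq sF.
have := @overlap_off_pair F G (polarize p F) (polarize p G) p np.
rewrite !polarize1 !polarize2 // => /(_ (fun z z1 z2 =>
  conj (esym (polarize_off F z1 z2)) (esym (polarize_off G z1 z2)))).
by move: sF sG; rewrite /steep;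
  move: (F p.1) (F p.2) (G p.1) (G p.2) => a b c d; lia.
Qed.

Lemma overlap_polarize1 p F G : steep p F -> steep p G ->
  overlap F (polarize p G) <= overlap (polarize p F) G.
Proof.
move=> sF sG; have np := steep_neq sF.
have := @overlap_off_pair F (polarize p G) (polarize p F) G p np.
rewrite !polarize1 !polarize2 // => /(_ (fun z z1 z2 =>
  conj (esym (polarize_off F z1 z2)) (polarize_off G z1 z2))).
by move: sF sG; rewrite /steep;
  move: (F p.1) (F p.2) (G p.1) (G p.2) => a b c d; lia.
Qed.

Lemma overlap_polarize0 p F G : steep p F -> ~~ steep p G ->
  overlap F G <= overlap (polarize p F) G.
Proof.
move=> sF sG; have np := steep_neq sF.
have := @overlap_off_pair F G (polarize p F) G p np.
rewrite !polarize1 !polarize2 // => /(_ (fun z z1 z2 =>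
  conj (esym (polarize_off F z1 z2)) erefl)).
by move: sF sG; rewrite /steep;
  move: (F p.1) (F p.2) (G p.1) (G p.2) => a b c d; lia.
Qed.

Lemma polarized_family k t (s : seq {ffun T -> nat}) : uniq s ->
    {in s, forall F, mass F = k} -> {in s &, forall F G, t <= overlap F G} ->
  exists s' : seq {ffun T -> nat},
    [/\ uniq s', {in s', forall F, mass F = k}, {in s' &, forall F G, t <= overlap F G},
        forall p F, F \in s' -> steep p F -> polarize p F \in s'
      & size s' = size s].
Proof.
move=> us ts ms.
have [s' [us' ms' stab allQ sumf]] :=
  @compressed_family _ _ steep polarize overlap (fun F => \sum_z F z ^ 2) t overlapC
    polarize_inj energy_polarize overlap_polarize2 overlap_polarize1
    overlap_polarize0 s us ms.
exists s'; split=> //; last by rewrite -!sum1_size sumf.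
have /allP ts' : all (fun F => mass F == k) s'.
  apply: allQ => [p F sF /eqP <-|]; first by rewrite mass_polarize.
  by apply/allP => F sF; rewrite ts.
by move=> F /ts'/eqP.
Qed.

Lemma card_supp_leq F : #|supp F| <= mass F.
Proof.
rewrite -sum1_card big_mkcond; apply: leq_sum => z _.
by rewrite inE; case: (F z).
Qed.

(** Induction on the overlap of F and G.  If their multiplicities are never both
    at least 2, then the overlap is the size of the common support.  Otherwise
    let i be a point where both are at least 2: the pointwise maximum of F and G has mass at most
    2k - t and multiplicity at least 2 at i, so it misses some j.  Exchanging
    (F i, 0) for (1, F i - 1) at (i, j) changes neither the common support nor
    the membership, but lowers the overlap. *)
Lemma supp_overlap k t (s : seq {ffun T -> nat}) : 2 * k - t <= #|T| ->
    {in s, forall F, mass F = k} -> {in s &, forall F G, t <= overlap F G} ->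
    (forall p F, F \in s -> steep p F -> polarize p F \in s) ->
  {in s &, forall F G, t <= #|supp F :&: supp G|}.
Proof.
move=> leT ts ms stab F G; have [b] := ubnP (overlap F G).
elim: b F => // b IHb F leb sF sG.
case: (boolP [exists i, (1 < F i) && (1 < G i)]); last first.
  move=> /existsPn no2; apply: leq_trans (ms _ _ sF sG) _; apply: eq_leq.
  rewrite -sum1_card [RHS]big_mkcond; apply: eq_bigr => z _.
  have := no2 z; rewrite !inE.
  by case: (F z) => [|[|?]]; case: (G z) => [|[|?]].
case/existsP=> i /andP[Fi Gi].
have [j nj] : exists j, j \notin supp F :|: supp G.
  apply/existsP; rewrite -negb_forall; apply/negP => /forallP cover.
  have : \sum_z (1 + (z == i)) + overlap F G <= mass F + mass G.
    rewrite /overlap /mass -!big_split; apply: leq_sum => z _ /=.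
    have := cover z; rewrite !inE; case: (eqVneq z i) => [->|_].
      by move: Fi Gi; move: (F i) (G i) => u v; lia.
    by move: (F z) (G z) => u v; lia.
  have -> : \sum_z (1 + (z == i)) = #|T| + 1.
    rewrite big_split sum1_card (bigD1 i) //= eqxx big1 // => z /negPf.
    by move=> ->.
  by rewrite !ts //; have := ms _ _ sF sG; lia.
move: nj; rewrite !inE negb_or !negbK => /andP[/eqP Fj /eqP Gj].
pose p := (i, j); have stF : steep p F by rewrite /steep /= Fj.
have np := steep_neq stF.
have overlap_lt : overlap (polarize p F) G < overlap F G.
  have := @overlap_off_pair F G (polarize p F) G p np.
  rewrite !polarize1 !polarize2 // => /(_ (fun z z1 z2 =>
    conj (esym (polarize_off F z1 z2)) erefl)).
  by move: Fi Gi; rewrite /= Fj Gj; move: (F i) (G i) => u v; lia.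
have -> : supp F :&: supp G = supp (polarize p F) :&: supp G.
  apply/setP => z; rewrite !inE ffunE /=.
  have [->|zi] := eqVneq z i; first by move: Fi; case: (F i).
  by have [->|zj] := eqVneq z j; first by rewrite Gj !andbF.
apply: IHb => //; first exact: leq_trans overlap_lt leb.
exact: stab.
Qed.

(** * Multisets with a given support *)

(** Pascal recurrence: fix x in S and decrease the multiplicity of x by one. The
    support becomes S - x if the multiplicity was 1, and remains S otherwise. *)
Lemma count_supp (k l : nat) (S : {set T}) (s : seq {ffun T -> nat}) : uniq s ->
    {in s, forall F, mass F = k.+1 /\ supp F = S} -> #|S| = l.+1 ->
  size s <= 'C(k, l).
Proof.
elim: k l S s => [|k IHk] l S s us inS cS.
  (* A multiset of mass 1 is determined by its support. *)
  have cF F : F \in s -> l = 0 /\ F = [ffun z => (z \in S) : nat].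
    move=> sF; have [tF sS] := inS _ sF.
    have := card_supp_leq F; rewrite tF sS cS => le1; split; first by lia.
    have [z eqS] : exists z, S = [set z] by apply/cards1P; lia.
    have Fz y : y != z -> F y = 0.
      move=> yz; have : y \notin supp F by rewrite sS eqS inE.
      by rewrite inE negbK => /eqP.
    apply/ffunP => y; rewrite ffunE eqS inE; case: eqVneq => [->|/Fz] //.
    by move: tF; rewrite /mass (bigD1 z) //= big1 ?addn0 // => x /Fz.
  case: s us inS cF => // F s us inS cF.
  have [-> _] := cF F (mem_head _ _); rewrite bin0.
  case: s us inS cF => // G s us inS cF; move: us.
  have [_ ->] := cF F (mem_head _ _).
  have [|_ ->] := cF G; first by rewrite !inE eqxx orbT.
  by rewrite /= inE eqxx.
have /card_gt0P[x xS] : 0 < #|S| by rewrite cS.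
pose dec F : {ffun T -> nat} := [ffun z => F z - (z == x)].
have Fx_gt0 F : F \in s -> 0 < F x.
  by move=> /inS[_ eqS]; move: xS; rewrite -eqS inE lt0n.
have dec_inj (s' : seq {ffun T -> nat}) : {subset s' <= s} -> {in s' &, injective dec}.
  move=> ss F G /ss/Fx_gt0 Fx /ss/Fx_gt0 Gx eqFG; apply/ffunP => z.
  have : dec F z = dec G z by rewrite eqFG.
  rewrite !ffunE; case: eqVneq => [->|_]; last by rewrite !subn0.
  by rewrite !subn1 => eqFx; rewrite -(prednK Fx) eqFx prednK.
have mass_dec F : F \in s -> mass (dec F) = k.+1.
  move=> sF; have [tF _] := inS _ sF; have Fx := Fx_gt0 _ sF.
  move: tF; rewrite /mass (bigD1 x) //= [\sum_z dec F z](bigD1 x) //= ffunE eqxx.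
  rewrite -(prednK Fx) subn1 addSn => -[<-]; congr (_ + _).
  by apply: eq_bigr => z /negPf zx; rewrite ffunE zx subn0.
pose a F := F x == 1.
rewrite -(count_predC a) -!size_filter.
have sub_a (b : pred {ffun T -> nat}) : {subset filter b s <= s}.
  by move=> F; rewrite mem_filter => /andP[].
have supp_dec F : F \in s -> supp (dec F) = if a F then S :\ x else S.
  move=> sF; have [_ <-] := inS _ sF; have := Fx_gt0 _ sF.
  rewrite /a; case: eqVneq => [F1 _|F1 Fx]; apply/setP => z; rewrite !inE ffunE.
    by case: (eqVneq z x) => [->|_]; rewrite ?F1 ?subn0.
  case: (eqVneq z x) => [->|_]; last by rewrite subn0.
  by case: (F x) F1 Fx => [|[]].
have le_big : size (filter (predC a) s) <= 'C(k, l).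
  rewrite -(size_map dec); apply: (IHk l S) => //.
    by rewrite map_inj_in_uniq ?filter_uniq //; apply/dec_inj/sub_a.
  move=> _ /mapP[F /[dup] /sub_a sF + ->]; rewrite mem_filter => /andP[/negPf /= aF _].
  by rewrite mass_dec // supp_dec // aF.
have small F : F \in filter a s -> F \in s /\ supp (dec F) = S :\ x.
  by move=> /[dup] /sub_a sF; rewrite mem_filter supp_dec // => /andP[-> _].
have us1 : uniq [seq dec F | F <- filter a s].
  by rewrite map_inj_in_uniq ?filter_uniq //; apply/dec_inj/sub_a.
have cS1 : #|S :\ x| = l by move: cS; rewrite (cardsD1 x S) xS => -[].
case: l cS cS1 le_big => [|l] cS cS1 le_big.
  suff -> : filter a s = [::] by rewrite !bin0 in le_big *.
  case def_s: (filter a s) => [//|F s']; have [|sF sd] := small F.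
    by rewrite def_s mem_head.
  have := mass_dec _ sF; rewrite /mass big1 // => z _.
  have : z \notin supp (dec F) by rewrite sd (cards0_eq cS1) inE.
  by rewrite inE negbK => /eqP.
rewrite binS addnC leq_add // -(size_map dec); apply: (IHk l (S :\ x)) => //.
by move=> _ /mapP[F /small[sF sd] ->]; rewrite mass_dec.
Qed.

(** With m = |T| and M = k - 1, the weight of a support of size s >= 1 is
    C(k-1, k-s) = C(k-1, s-1). *)
Lemma size_by_supp k (s : seq {ffun T -> nat}) : 0 < k -> uniq s ->
    {in s, forall F, mass F = k} ->
  size s <= \sum_(S in [set S | S \in map supp s]) wt k k.-1 #|S|.
Proof.
case: k => // k _ us ts.
have -> : size s =
    \sum_(S in [set S | S \in map supp s]) count (fun F => supp F == S) s.
  rewrite -sum1_size; under [RHS]eq_bigr do rewrite -sum1_count big_mkcond.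
  rewrite exchange_big; apply: eq_big_seq => F sF.
  rewrite (bigD1 (supp F)) ?inE ?map_f //= eqxx big1 ?addn0 // => S /andP[_].
  by rewrite eq_sym => /negPf ->.
apply: leq_sum => S; rewrite inE => /mapP[F sF ->].
have le_k : #|supp F| <= k.+1 by rewrite -(ts _ sF) card_supp_leq.
have F_gt0 : 0 < #|supp F|.
  rewrite lt0n cards_eq0; apply: contra_eq_neq (ts _ sF) => F0.
  rewrite /mass big1 // => z _; have : z \notin supp F by rewrite F0 inE.
  by rewrite inE negbK => /eqP.
rewrite /wt le_k mul1n -size_filter.
have -> : 'C(k, k.+1 - #|supp F|) = 'C(k, #|supp F|.-1).
  by rewrite -bin_sub; [congr 'C(_, _); lia | lia].
apply: (@count_supp _ _ (supp F)); rewrite ?filter_uniq ?prednK // => G.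
by rewrite mem_filter => /andP[/eqP sG] /ts.
Qed.

End Multisets.

(** * The bound for multisets *)

Theorem t_intersecting_multisets (T : finType) (k t : nat) (s : seq {ffun T -> nat}) :
    0 < t -> t <= k -> t * (k - t) + 2 <= #|T| -> uniq s ->
    {in s, forall F, mass F = k} -> {in s &, forall F G, t <= overlap F G} ->
  size s <= 'C(#|T| + k - t - 1, k - t).
Proof.
move=> t_gt0 le_tk leT us ts ms.
case: (ltngtP t k) le_tk => // [lt_tk | eq_tk] _; last first.
  rewrite eq_tk subnn bin0.
  (* An overlap equal to the mass forces equality of the multisets. *)
  have eqF F G : F \in s -> G \in s -> F = G.
    have leFG F' G' : F' \in s -> G' \in s -> forall z, F' z <= G' z.
      move=> sF sG z; have := ms _ _ sF sG.
      have le_rest : \sum_(y | y != z) minn (F' y) (G' y) <= \sum_(y | y != z) F' y.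
        by apply: leq_sum => y _; apply: geq_minl.
      rewrite eq_tk -(ts _ sF) /overlap /mass (bigD1 z) //= [leqRHS](bigD1 z) //=.
      move=> le_min; have := leq_trans le_min (leq_add (leqnn _) le_rest).
      by rewrite leq_add2r leq_min leqnn.
    by move=> *; apply/ffunP => z; apply/eqP; rewrite eqn_leq !leFG.
  case: s us eqF {ts ms} => // F [|G s] // us eqF.
  by move: us; rewrite (eqF F G) /= ?inE ?eqxx ?orbT.
have [s' [us' ts' ms' stab <-]] := polarized_family us ts ms.
pose GG := [set S | S \in map (@supp T) s'].
have tGG : {in GG &, forall A B : {set T}, t <= #|A :&: B|}.
  have overlap_supp : {in s' &, forall F G, t <= #|supp F :&: supp G|}.
    (* For t >= 2 and k > t, t(k-t)+2 - (2k-t) = (t-2)(k-t-1) >= 0. *)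
    case: (ltngtP t 1) => [|t_gt1|t1]; first by rewrite ltnNge t_gt0.
      by apply: supp_overlap ts' ms' stab; nia.
    move=> F G sF sG; rewrite t1 lt0n; apply: contraTneq (ms' _ _ sF sG) => FG0.
    rewrite -ltnNge t1 /overlap big1 // => z _.
    have : z \notin supp F :&: supp G by rewrite (cards0_eq FG0) inE.
    by rewrite !inE negb_and !negbK => /orP[]/eqP->; rewrite ?min0n ?minn0.
  by move=> A B; rewrite !inE => /mapP[F sF ->] /mapP[G sG ->]; apply: overlap_supp.
apply: leq_trans (size_by_supp (leq_trans t_gt0 (ltnW lt_tk)) us' ts') _.
have -> : #|T| + k - t - 1 = k.-1 + #|[set: T]| - t by rewrite cardsT; lia.
apply: weighted_t_intersecting => //; first exact: ltnW.
  by rewrite cardsT; nia.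
Qed.

Local Open Scope fset_scope.
Local Open Scope mset_scope.
Local Open Scope nat_scope.

Theorem mainTheorem3 (k t n : nat)
    (k_gt0 : 0 < k) (t_gt0 : 0 < t) (n_gt0 : 0 < n)
    (le_tk : t <= k) (le_n : t * (k - t) + 2 <= n)
    (FF : {fset {mset 'I_n}})
    (FF_k : forall F : {mset 'I_n}, F \in FF -> k_multiset k F)
    (FF_t : t_intersecting t FF) :
  #|` FF| <= 'C(n + k - t - 1, k - t).
Proof.
pose mult (F : {mset 'I_n}) : {ffun 'I_n -> nat} := [ffun i => F i].
have mult_inj : injective mult.
  by move=> F G /ffunP eqFG; apply/msetP => i; have := eqFG i; rewrite !ffunE.
have -> : #|` FF| = size (map mult (enum_fset FF)) by rewrite size_map.
have := @t_intersecting_multisets 'I_n k t (map mult (enum_fset FF)).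
rewrite card_ord; apply=> //.
- by rewrite map_inj_uniq ?fset_uniq.
- move=> _ /mapP[F FFF ->]; rewrite -(FF_k _ FFF).
  by apply: eq_bigr => i _; rewrite ffunE.
- move=> _ _ /mapP[F FFF ->] /mapP[G FFG ->].
  apply: leq_trans (FF_t _ _ FFF FFG) _; apply: eq_leq.
  by apply: eq_bigr => i _; rewrite !ffunE msetE2.
Qed.
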